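(* Let $G$ be a finite abelian group, let $\mathbb{F}$ be a field whose characteristic does not divide $|G|$, and let $K$ be an extension field of $\mathbb{F}$ containing an element of multiplicative order $\exp(G)$. Let $V$ be the $K$-vector space with basis $\{e_\chi\mid\chi\in\widehat G\}$, on which $G$ acts by $g\cdot\sum_{\chi\in\widehat G}v_\chi e_\chi=\sum_{\chi\in\widehat G}\chi(g)v_\chi e_\chi$. Let $v=\sum_\chi v_\chi e_\chi$ and $w=\sum_\chi w_\chi e_\chi$ be vectors in $V$ such that $v_\chi\neq 0$ and $w_\chi\neq 0$ for all $\chi\in\widehat G\setminus\{1_{\widehat G}\}$. Then the $G$-orbit of $v$ coincides with the $G$-orbit of $w$ if and only if $f(v)=f(w)$ for all $f\in T$, where $$T=\{x_{1_{\widehat G}},\quad x_\chi x_{\chi^{-1}},\quad x_\chi x_\rho x_{(\chi\rho)^{-1}}\mid \chi,\rho\in\widehat G\setminus\{1_{\widehat G}\}\}.$$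
   Context: $\exp(G)$ is the least common multiple of the orders of the elements of $G$. $\widehat G$ is the group of group homomorphisms from $G$ to the multiplicative group $K^\times$, under pointwise multiplication, with identity $1_{\widehat G}$. $K[x_\chi\mid\chi\in\widehat G]$ is the polynomial algebra whose variables are the coordinate functions on $V$: $x_\rho(\sum_{\chi}v_\chi e_\chi)=v_\rho$ for $\rho\in\widehat G$. *)

(* Defs.v *)
From HB Require Import structures.
From mathcomp Require Import all_boot all_order all_algebra all_fingroup.
From mathcomp Require Import all_solvable finmap classical_sets.
From mathcomp.multinomials Require Import monalg.

Set Implicit Arguments.
Unset Strict Implicit.
Unset Printing Implicit Defensive.

Import GRing.Theory.
Local Open Scope ring_scope.

(* The multiplicative group of a field. [{unit K}] of [finalg] is restricted
   to finite rings. *)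
Section MultiplicativeGroup.
Variable K : fieldType.

Record mulgrp : predArgType := MulGrp { mulgrp_val : K; _ : mulgrp_val != 0 }.

HB.instance Definition _ := [isSub for mulgrp_val].
HB.instance Definition _ := [Choice of mulgrp by <:].

Implicit Types a b c : mulgrp.

Lemma mulgrp_neq0 a : val a != 0. Proof. by case: a. Qed.

Definition mulgrp_one : mulgrp := MulGrp (oner_neq0 K).

Fact mulgrp_mul_subproof a b : val a * val b != 0.
Proof. by rewrite mulf_neq0 ?mulgrp_neq0. Qed.

Definition mulgrp_mul a b : mulgrp := MulGrp (mulgrp_mul_subproof a b).

Fact mulgrp_inv_subproof a : (val a)^-1 != 0.
Proof. by rewrite invr_eq0 mulgrp_neq0. Qed.

Definition mulgrp_inv a : mulgrp := MulGrp (mulgrp_inv_subproof a).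

Fact mulgrp_mulA : associative mulgrp_mul.
Proof. by move=> a b c; apply/val_inj; rewrite /= mulrA. Qed.

Fact mulgrp_mul1 : left_id mulgrp_one mulgrp_mul.
Proof. by move=> a; apply/val_inj; rewrite /= mul1r. Qed.

Fact mulgrp_mulr1 : right_id mulgrp_one mulgrp_mul.
Proof. by move=> a; apply/val_inj; rewrite /= mulr1. Qed.

Fact mulgrp_mulV : left_inverse mulgrp_one mulgrp_inv mulgrp_mul.
Proof. by move=> a; apply/val_inj; rewrite /= mulVf ?mulgrp_neq0. Qed.

Fact mulgrp_mulrV : right_inverse mulgrp_one mulgrp_inv mulgrp_mul.
Proof. by move=> a; apply/val_inj; rewrite /= mulfV ?mulgrp_neq0. Qed.

HB.instance Definition _ := isMonoid.Build mulgrp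
  mulgrp_mulA mulgrp_mul1 mulgrp_mulr1.
HB.instance Definition _ := hasInv.Build mulgrp mulgrp_inv.
HB.instance Definition _ := Monoid_isGroup.Build mulgrp
  mulgrp_mulV mulgrp_mulrV.

Lemma val_mulgrp1 : val (1%g : mulgrp) = 1. Proof. by []. Qed.

Lemma val_mulgrpM a b : val (a * b)%g = val a * val b. Proof. by []. Qed.

Lemma val_mulgrpV a : val (a^-1)%g = (val a)^-1. Proof. by []. Qed.

Lemma mulgrpC : @commutative mulgrp _ (fun a b => a * b)%g.
Proof. by move=> a b; apply/val_inj; rewrite !val_mulgrpM mulrC. Qed.

End MultiplicativeGroup.

(* The homomorphisms from G to the multiplicative group of K, as a subgroup of
   the group of all functions under pointwise multiplication. *)
Section Dual.
Variables (gT : finGroupType) (K : fieldType).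

Definition is_hom (f : {ffun gT -> mulgrp K}) : bool :=
  [forall x, forall y, f (x * y)%g == (f x * f y)%g].

Lemma is_homP (f : {ffun gT -> mulgrp K}) :
  reflect {morph f : x y / (x * y)%g} (is_hom f).
Proof.
apply: (iffP forallP) => [h x y|h x]; first by have /forallP/(_ y)/eqP := h x.
by apply/forallP => y; rewrite h.
Qed.

Record dualgrp : predArgType :=
  DualGrp { dual_val :> {ffun gT -> mulgrp K}; _ : is_hom dual_val }.

HB.instance Definition _ := [isSub for dual_val].
HB.instance Definition _ := [Choice of dualgrp by <:].

Lemma is_hom_group_closed : group_closed is_hom.
Proof.
split; last first.
  move=> f h; rewrite -!topredE /= => /is_homP Hf /is_homP Hh.
  apply/is_homP => x y; rewrite !ffunE Hf Hh; apply/val_inj.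
  by rewrite /= invfM mulrACA.
by apply/is_homP => x y; rewrite !ffunE mulg1.
Qed.

HB.instance Definition _ := SubChoice_isSubGroup.Build
  {ffun gT -> mulgrp K} is_hom dualgrp is_hom_group_closed.

Fact dual_monoid_morphism (chi : dualgrp) : monoid.monoid_morphism chi.
Proof.
have chiM := elimT (is_homP chi) (valP chi); split=> //.
by apply: (mulgI (chi 1%g)); rewrite -chiM !mulg1.
Qed.

HB.instance Definition _ (chi : dualgrp) :=
  isUMagmaMorphism.Build gT (mulgrp K) chi (dual_monoid_morphism chi).

Lemma dual1E g : (1%g : dualgrp) g = 1%g. Proof. by rewrite ffunE. Qed.

Lemma dualME (chi rho : dualgrp) g : (chi * rho)%g g = (chi g * rho g)%g.
Proof. by rewrite ffunE. Qed.

Lemma dualVE (chi : dualgrp) g : (chi^-1)%g g = ((chi g)^-1)%g.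
Proof. by rewrite ffunE. Qed.

Lemma dualP (chi rho : dualgrp) : (forall g, chi g = rho g) <-> chi = rho.
Proof. by split=> [h|-> //]; apply/val_inj/ffunP. Qed.

End Dual.

(* Polynomials over K in the variables x_i, i : I, and their evaluation at
   points of the free K-module on I. *)
Section Polynomials.
Variables (I : choiceType) (K : fieldType).

Definition polyvar (i : I) : {malg K[{cmonom I}]} := << ucm i >>.

Definition cmeval (v : {malg K[I]}) (m : {cmonom I}) : K :=
  \prod_(i <- finsupp m) v@_i ^+ m i.

Definition meval (v : {malg K[I]}) (f : {malg K[{cmonom I}]}) : K :=
  mmap idfun (cmeval v) f.

Lemma cmevalEw v (d : {fset I}) (m : {cmonom I}) : (finsupp m `<=` d)%fset ->
  cmeval v m = \prod_(i <- d) v@_i ^+ m i.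
Proof.
move=> le; rewrite /cmeval (big_fset_incl _ le) => //= i _.
by move/fsfun_dflt => ->; rewrite expr0.
Qed.

Lemma cmeval_is_mmorphism v : mmorphism (cmeval v).
Proof.
split=> [m1 m2|]; last by rewrite /cmeval mdom1 big_seq_fset0.
rewrite {1}/cmeval mdomD.
rewrite (cmevalEw _ (fsubsetUl (finsupp m1) (finsupp m2))).
rewrite (cmevalEw _ (fsubsetUr (finsupp m1) (finsupp m2))) -big_split /=.
by apply: eq_bigr => i _; rewrite cmM exprD.
Qed.

HB.instance Definition _ v :=
  monalg.isMultiplicative.Build {cmonom I} K (cmeval v)
    (cmeval_is_mmorphism v).

HB.instance Definition _ v := GRing.RMorphism.copy (meval v)
  (mmap idfun (cmeval v)).

Lemma mevalX v i : meval v (polyvar i) = v@_i.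
Proof.
by rewrite /meval mmapU mul1r /cmeval mdomU big_seq_fset1 cmUU expr1.
Qed.

Lemma mevalC v c : meval v c%:MP = c.
Proof. exact: mmapC. Qed.

End Polynomials.

(* The vector space V with basis indexed by the dual group is the free module
   {malg K[dualgrp gT K]}: its basis vectors are the << chi >>, and v@_chi is the
   coordinate of v on << chi >>. *)
Section Orbits.
Variables (gT : finGroupType) (K : fieldType).

Implicit Types (v : {malg K[dualgrp gT K]}) (chi rho : dualgrp gT K).

Definition dact (g : gT) v : {malg K[dualgrp gT K]} :=
  \sum_(chi <- msupp v) (val (chi g) * v@_chi) *: << chi >>.

Lemma mcoeff_dact g v chi : (dact g v)@_chi = val (chi g) * v@_chi.
Proof.
rewrite /dact raddf_sum /=.
under eq_bigr => rho _ do rewrite mcoeffZ mcoeffU.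
case: (boolP (chi \in msupp v)) => [chi_v|chi_v].
  rewrite (big_fsetD1 chi) //= eqxx mulr1 big_seq big1 ?addr0 // => rho.
  by rewrite !inE => /andP[/negPf -> _]; rewrite mulr0.
rewrite (mcoeff_outdom chi_v) mulr0 big_seq big1 // => rho rho_v.
case: eqVneq rho_v => [->|_ _]; last by rewrite mulr0.
by rewrite (negPf chi_v).
Qed.

Lemma dact1 v : dact 1%g v = v.
Proof. by apply/malgP => chi; rewrite mcoeff_dact gmulf1 mul1r. Qed.

Lemma dactM g h v : dact (g * h)%g v = dact g (dact h v).
Proof. by apply/malgP => chi; rewrite !mcoeff_dact gmulfM mulrA. Qed.

Definition dorbit v : set {malg K[dualgrp gT K]} :=
  range (dact^~ v).

Definition nontrivial_dual : set (dualgrp gT K) :=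
  [set chi | chi != 1%g]%classic.

Definition coordvar (chi : dualgrp gT K) : {malg K[{cmonom dualgrp gT K}]} :=
  polyvar K chi.

Definition sepset : set {malg K[{cmonom dualgrp gT K}]} :=
  ([set coordvar 1%g]
   `|` [set coordvar chi * coordvar (chi^-1)%g | chi in nontrivial_dual]
   `|` [set coordvar chi * coordvar rho * coordvar ((chi * rho)^-1)%g
         | chi in nontrivial_dual & rho in nontrivial_dual])%classic.

End Orbits.

Arguments nontrivial_dual : clear implicits.
Arguments sepset : clear implicits.

(* Main.v *)
(** If the orbit polynomials in [T] agree at [v] and [w], the ratios
    [w_chi / v_chi] (set to 1 at the trivial character, where [v] and [w] may
    vanish) form a homomorphism [t] from the dual group to the units
    of [K], and it remains to see that [t] is evaluation at some [g] in [G].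
    Otherwise each [g] has a character [chi_g] with [t chi_g != chi_g g].
    The function [h |-> \prod_g (chi_g h - chi_g g)] vanishes on [G]; expanding
    it gives a linear relation between characters, which is formally trivial by
    Dedekind's independence theorem. So it still holds with [t chi] in place of
    [chi h], that is [\prod_g (t chi_g - chi_g g) = 0]: a contradiction. *)
Require Import Defs.
From HB Require Import structures.
From mathcomp Require Import all_boot all_order all_algebra all_fingroup.
From mathcomp Require Import all_solvable finmap classical_sets.
From mathcomp Require Import boolp.
From mathcomp.multinomials Require Import monalg.

Set Implicit Arguments.
Unset Strict Implicit.
Unset Printing Implicit Defensive.

Import GRing.Theory.
Local Open Scope ring_scope.

Section DualEvaluation.
Variables (gT : finGroupType) (K : fieldType).
Implicit Types (chi rho : dualgrp gT K) (g h : gT).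

Lemma val_dualM chi g h : val (chi (g * h)%g) = val (chi g) * val (chi h).
Proof. by rewrite gmulfM. Qed.

Lemma val_dualME chi rho g :
  val ((chi * rho)%g g) = val (chi g) * val (rho g).
Proof. by rewrite dualME. Qed.

Lemma dual_independence (s : seq (dualgrp gT K)) (c : dualgrp gT K -> K) :
    uniq s -> (forall g, \sum_(chi <- s) c chi * val (chi g) = 0) ->
  forall chi, chi \in s -> c chi = 0.
Proof.
elim: s c => [//|rho s IHs] c /= /andP[rho_s uniq_s] sum0.
have c_s chi : chi \in s -> c chi = 0.
  move=> chi_s; apply/eqP; apply: contraT => c_neq0.
  have chi_rho : chi = rho.
    apply/dualP => h; apply/val_inj/eqP; rewrite -subr_eq0.
    suff /eqP : c chi * (val (chi h) - val (rho h)) = 0.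
      by rewrite mulf_eq0 (negPf c_neq0).
    apply: (IHs (fun chi => c chi * (val (chi h) - val (rho h)))) => // g.
    have := congr2 (fun x y => x - val (rho h) * y) (sum0 (h * g)%g) (sum0 g).
    rewrite mulr0 subr0; apply: etrans; rewrite !big_cons mulrDr mulr_sumr.
    rewrite val_dualM mulrCA opprD addrACA subrr add0r -sumrB.
    apply: eq_bigr => sigma _.
    by rewrite val_dualM mulrBr mulrBl mulrA [in RHS]mulrCA mulrA.
  by rewrite -chi_rho chi_s in rho_s.
move=> chi; rewrite inE => /predU1P[->|/c_s //].
have := sum0 1%g; rewrite big_cons big_seq big1 => [|sigma /c_s ->].
  by rewrite addr0 gmulf1 mulr1.
by rewrite mul0r.
Qed.

Lemma dual_relation (I : finType) (X : I -> dualgrp gT K) (c : I -> K)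
    (t : dualgrp gT K -> K) :
    (forall g, \sum_i c i * val (X i g) = 0) ->
  \sum_i c i * t (X i) = 0.
Proof.
move=> sum0; pose s := undup (codom X).
have group (u : dualgrp gT K -> K) : \sum_i c i * u (X i) =
    \sum_(chi <- s) (\sum_(i | X i == chi) c i) * u chi.
  under [RHS]eq_bigr => chi _ do rewrite mulr_suml.
  rewrite (exchange_big_dep xpredT) //=; apply: eq_bigr => i _.
  rewrite -big_filter (perm_big [:: X i]) ?big_seq1 //.
  apply: uniq_perm => [||chi]; rewrite ?filter_uniq ?undup_uniq //.
  rewrite mem_filter mem_undup inE eq_sym.
  by case: eqP => [->|//]; rewrite codom_f.
rewrite group big_seq big1 // => chi chi_s.
rewrite (dual_independence (c := fun chi => \sum_(i | X i == chi) c i)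
  (undup_uniq _) _ chi_s) ?mul0r // => g.
by rewrite -(group (fun chi => val (chi g))).
Qed.

Lemma dual_evaluation (t : dualgrp gT K -> K) :
    t 1%g = 1 -> {morph t : chi rho / (chi * rho)%g >-> chi * rho} ->
  exists g, forall chi, t chi = val (chi g).
Proof.
move=> t1 tM; apply: contrapT => no_g.
have /choice[X tX] : forall g, exists chi, t chi != val (chi g).
  move=> g; apply: contrapT => no_chi; apply: no_g; exists g => chi.
  by apply/eqP; apply: contrapT => /negP neq; apply: no_chi; exists chi.
pose Y (A : {set gT}) := (\prod_(g in A) X g)%g.
pose c (A : {set gT}) := \prod_(g | g \notin A) - val (X g g).
have expand (u : dualgrp gT K -> K) : u 1%g = 1 ->
    {morph u : chi rho / (chi * rho)%g >-> chi * rho} ->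
    \prod_g (u (X g) - val (X g g)) = \sum_A c A * u (Y A).
  move=> u1 uM; rewrite bigA_distr; apply: eq_bigr => A _.
  rewrite (bigID (mem A)) /= mulrC (big_morph u uM u1); congr (_ * _).
    by apply: eq_bigr => g /negPf ->.
  by apply: eq_bigr => g ->.
have : \prod_g (t (X g) - val (X g g)) != 0.
  by apply/prodf_neq0 => g _; rewrite subr_eq0.
rewrite (expand t) // dual_relation ?eqxx // => h.
rewrite -(expand (fun chi => val (chi h))).
- by rewrite (bigD1 h) //= subrr mul0r.
- by rewrite dual1E.
- by move=> chi rho; rewrite dualME.
Qed.

Lemma dorbit_dact g (v : {malg K[dualgrp gT K]}) :
  dorbit (dact g v) = dorbit v.
Proof.
apply/seteqP; split=> _ [h _ <-].
  by exists (h * g)%g; [|exact: dactM].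
exists (h * g^-1)%g; [by []|rewrite -[in RHS](mulgKV g h)].
exact/esym/dactM.
Qed.

Lemma meval_coordvarM (v : {malg K[dualgrp gT K]}) chi rho :
  meval v (coordvar chi * coordvar rho) = v@_chi * v@_rho.
Proof. by apply: etrans (rmorphM _ _ _) _; congr (_ * _); apply: mevalX. Qed.

Lemma meval_coordvarMM (v : {malg K[dualgrp gT K]}) chi rho sigma :
  meval v (coordvar chi * coordvar rho * coordvar sigma) =
    v@_chi * v@_rho * v@_sigma.
Proof.
apply: etrans (rmorphM _ _ _) _.
by congr (_ * _); [apply: meval_coordvarM|apply: mevalX].
Qed.

Lemma sepset_dact g (v : {malg K[dualgrp gT K]}) f :
  sepset gT K f -> meval (dact g v) f = meval v f.
Proof.
case=> [[->|[chi _ <-]]|[chi _ [rho _ <-]]].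
- by rewrite !mevalX mcoeff_dact dual1E mul1r.
- rewrite 2!meval_coordvarM 2!mcoeff_dact mulrACA.
  by rewrite -val_dualME mulgV dual1E mul1r.
- rewrite 2!meval_coordvarMM 3!mcoeff_dact [X in X * _ = _]mulrACA [LHS]mulrACA.
  by rewrite -2!val_dualME mulgV dual1E mul1r.
Qed.

End DualEvaluation.

Theorem proposition3p2
  (gT : finGroupType) (abelian_gT : abelian [set: gT])
  (F : fieldType)
  (char_F : forall p : nat, p \in [pchar F] -> ~~ (p %| #|gT|)%N)
  (K : fieldType) (iota : {rmorphism F -> K})
  (root_K : exists z : K, (exponent [set: gT]).-primitive_root z)
  (v w : {malg K[dualgrp gT K]})
  (v_neq0 : forall chi : dualgrp gT K, chi != 1%g -> v@_chi != 0)
  (w_neq0 : forall chi : dualgrp gT K, chi != 1%g -> w@_chi != 0) :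
  dorbit v = dorbit w <->
  (forall f : {malg K[{cmonom dualgrp gT K}]},
     sepset gT K f -> meval v f = meval w f).
Proof.
split=> [eq_orb f f_T|eqT].
  have : dorbit v v by exists 1%g; [|exact: dact1].
  by rewrite eq_orb => -[g _ <-]; apply: sepset_dact.
pose t (chi : dualgrp gT K) := if chi == 1%g then 1 else w@_chi / v@_chi.
have t1 : t 1%g = 1 by rewrite /t eqxx.
have wE chi : chi != 1%g -> w@_chi = t chi * v@_chi.
  by move=> chi1; rewrite /t (negPf chi1) divfK ?v_neq0.
have tV chi : t chi * t (chi^-1)%g = 1.
  have [->|chi1] := eqVneq chi 1%g; first by rewrite invg1 t1 mulr1.
  have chiV1 : (chi^-1)%g != 1%g by rewrite invg_eq1.
  have := eqT (coordvar chi * coordvar (chi^-1)%g).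
  rewrite 2!meval_coordvarM (wE _ chi1) (wE _ chiV1) mulrACA => /(_ _)/esym e.
  apply: (mulIf (mulf_neq0 (v_neq0 _ chi1) (v_neq0 _ chiV1))).
  by rewrite mul1r e //; left; right; exists chi.
have tM : {morph t : chi rho / (chi * rho)%g >-> chi * rho}.
  move=> chi rho.
  have [->|chi1] := eqVneq chi 1%g; first by rewrite mul1g t1 mul1r.
  have [->|rho1] := eqVneq rho 1%g; first by rewrite mulg1 t1 mulr1.
  have [cr1|cr1] := eqVneq (chi * rho)%g 1%g.
    by rewrite cr1 t1 -(mulg1_eq cr1) tV.
  have crV1 : ((chi * rho)^-1)%g != 1%g by rewrite invg_eq1.
  have := eqT (coordvar chi * coordvar rho * coordvar ((chi * rho)^-1)%g).
  rewrite 2!meval_coordvarMM (wE _ chi1) (wE _ rho1) (wE _ crV1) => /(_ _)/esym e.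
  have tcr : t chi * t rho * t ((chi * rho)^-1)%g = 1.
    apply: (mulIf (mulf_neq0 (mulf_neq0 (v_neq0 _ chi1) (v_neq0 _ rho1))
      (v_neq0 _ crV1))).
    rewrite mul1r -[RHS]e; last by right; exists chi => //; exists rho.
    by rewrite mulrACA [X in X * _ = _]mulrACA.
  by rewrite -[LHS]mul1r -tcr -mulrA [X in _ * X]mulrC tV mulr1.
have [g tE] := dual_evaluation t1 tM.
rewrite -(dorbit_dact g v); congr dorbit; apply/malgP => chi.
rewrite mcoeff_dact; have [->|chi1] := eqVneq chi 1%g; last by rewrite -tE wE.
have := eqT (coordvar 1%g); rewrite !mevalX dual1E mul1r; apply.
by left; left.
Qed.
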